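(* Let $p$ be a prime and let $k$ and $\ell$ be positive integers such that $k$ does not divide $\ell$. Then $L(H_k)$ does not divide $L(H_\ell)$ (as polynomials in $\mathbb Z[T]$).
   Context: For a positive integer $k$, $H_k=H_k^{(p)}$ denotes the (smooth projective) Hermitian curve $y^{p^k}+y=x^{p^k+1}$ over $\mathbb F_p$. For a smooth projective absolutely irreducible curve $X$ over $\mathbb F_p$, $L(X)=L_X(T)=\exp\left(\sum_{n\ge1}\left(\#X(\mathbb F_{p^n})-p^n-1\right)\frac{T^n}{n}\right)\in\mathbb Z[T]$ denotes its $L$-polynomial over $\mathbb F_p$. *)

(* Defs.v *)
(* MathComp *)
From HB Require Import structures.
From mathcomp Require Import all_boot all_order all_algebra all_field.

Set Implicit Arguments.
Unset Strict Implicit.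
Unset Printing Implicit Defensive.

Import GRing.Theory.
Local Open Scope ring_scope.

(* The exponent is m.+1, so that only positive exponents occur. *)
Definition gf (p : nat) (pr_p : prime p) (m : nat) : finFieldType :=
  s2val (pPrimePowerField pr_p (ltn0Sn m)).

Lemma card_gf (p : nat) (pr_p : prime p) (m : nat) :
  #|gf pr_p m| = (p ^ m.+1)%N.
Proof. exact: (s2valP' (pPrimePowerField pr_p (ltn0Sn m))). Qed.

(* Points of the projective plane over F are lines through 0 in F^3. *)
Definition line_through (F : finFieldType) (v : 'rV[F]_3) : {set 'rV[F]_3} :=
  [set a *: v | a : F].

Definition xcoord (F : finFieldType) (v : 'rV[F]_3) : F := v 0 (inord 0).
Definition ycoord (F : finFieldType) (v : 'rV[F]_3) : F := v 0 (inord 1).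
Definition zcoord (F : finFieldType) (v : 'rV[F]_3) : F := v 0 (inord 2).

(* Homogenization y^q z + y z^q = x^(q+1) of y^q + y = x^(q+1), q = p^k.  For
   k > 0 the gradient in characteristic p is (- x^q, z^q, y^q), which vanishes
   only at 0: this plane projective closure is already the smooth projective
   model. *)
Definition on_hermitian (p k : nat) (F : finFieldType) (v : 'rV[F]_3) : bool :=
  let q := (p ^ k)%N in
  let x := xcoord v in let y := ycoord v in let z := zcoord v in
  y ^+ q * z + y * z ^+ q == x ^+ q.+1.

Definition hermitian_points (p k : nat) (F : finFieldType)
    : {set {set 'rV[F]_3}} :=
  [set line_through v | v : 'rV[F]_3 & (v != 0) && on_hermitian p k v].

(* N m is the number of points over the field with p^m.+1 elements. *)
Definition hermitian_count (p : nat) (pr_p : prime p) (k : nat) : nat -> nat :=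
  fun m => #|hermitian_points p k (gf pr_p m)|.

(* Formal power series over rat are given by their coefficient sequences.
   This is exp(f) = \sum_j f^j / j!, meaningful when f 0 = 0; in that case
   only the terms j <= n and the coefficients f i, i <= n, contribute to the
   n-th coefficient. *)
Definition fps_exp (f : nat -> rat) : nat -> rat :=
  fun n => (\sum_(j < n.+1)
              (j`!%:R : rat)^-1 *: (\poly_(i < n.+1) f i) ^+ j)`_n.

Definition log_Lseries (p : nat) (N : nat -> nat) : nat -> rat :=
  fun n => if n is m.+1
           then ((N m)%:R - (p ^ n)%:R - 1) / n%:R
           else 0.

(* P is the L-polynomial over F_p of a curve with point counts N (indexed as in
   hermitian_count).  P is determined by N; its existence for a smooth
   projective absolutely irreducible curve is Weil's theorem. *)
Definition is_Lpoly (p : nat) (N : nat -> nat) (P : {poly int}) : Prop :=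
  forall n : nat, (P`_n)%:~R = fps_exp (log_Lseries p N) n.

(* Main.v *)
Require Import Defs.
From mathcomp Require Import all_boot all_order all_algebra all_field.
From mathcomp Require Import cyclic zify ring lra.

(** Put q = p^k. Over the field with q^2 elements the curve H_k is maximal:
    every Frobenius eigenvalue there is - q, and there are q(q - 1) of them.
    Hence each eigenvalue a of H_k over the prime field satisfies a^(2k) = - p^k
    (hermitian_Lpoly_roots). If L(H_k) divided L(H_l), the eigenvalues of H_k
    would also be eigenvalues of H_l and satisfy a^(2l) = - p^l. Squaring both
    relations and combining the exponents gives a^(4g) = p^(2g) for
    g = gcd(k, l). So over the extension of degree 4g all q(q - 1) eigenvalues
    equal p^(2g), and H_k has p^(4g) + 1 - q(q - 1) p^(2g) points there. When k
    does not divide l, 2g <= k, and this number is negative.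

    The eigenvalues are known once the points are counted over every extension
    of degree 2kn. Let F be the field with q^(2n) elements. Its points on the
    curve lie above the zeros of the Hermitian form h(x) = T(x^(q+1)), where T
    is an alternating trace whose kernel is the image of y |-> y^q + y
    (card_ker_im). All nonzero levels of h have the same size, by
    surjectivity of the norm (level_card_eq). The number of pairs (x, x') with
    h(x) = h(x') follows from the explicit polar form (second_moment), and
    this fixes the size of the zero level up to a sign. The sign is found
    modulo q + 1, which divides the size of each nonzero level
    (level_card_dvd, level_equations_sol).

    On the polynomial side, exp in the definition of the L-polynomial P gives
    P' = P f', and P = prod (1 - a X) over the algebraic numbers gives
    P' = - P sum_n (sum a^(n+1)) X^n, both modulo any power of X. This turns
    point counts into power sums of the eigenvalues (Lpoly_roots). Power sums
    that form a geometric progression force all entries to be equal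
    (power_sums_geometric). *)

Set Implicit Arguments.
Unset Strict Implicit.
Unset Printing Implicit Defensive.

Import Order.TTheory GRing.Theory Num.Theory.
Local Open Scope ring_scope.

(** * Roots of unity and additive maps in finite fields *)

Section RootsOfUnity.
Variable F : finFieldType.

Lemma finField_prim_root : {g : F | (#|F|.-1).-primitive_root g}.
Proof.
have lt1F : (1 < #|F|)%N by apply: finNzRing_gt1.
pose rs := enum (predC1 (0 : F)).
have srs : size rs = #|F|.-1 by rewrite -cardE cardC1.
have /sigW: exists g, (#|F|.-1).-primitive_root (g : F); last by case=> g; exists g.
have /hasP[g _ pg] : has (#|F|.-1).-primitive_root rs.
  apply: has_prim_root; rewrite ?srs //; first by lia.
    apply/allP=> x; rewrite mem_enum inE => x0; rewrite unity_rootE.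
    by rewrite -subn1 expfB_cond ?expf_card ?divff //; rewrite (negPf x0); lia.
  exact: enum_uniq.
by exists g.
Qed.

Lemma card_unity_roots m : (m %| #|F|.-1)%N -> #|[set a : F | a ^+ m == 1]| = m.
Proof.
have lt1F : (1 < #|F|)%N by apply: finNzRing_gt1.
have [g pg] := finField_prim_root => dm.
have pz := dvdn_prim_root pg dm; set z := g ^+ _ in pz.
have -> : [set a : F | a ^+ m == 1] = [set z ^+ i | i : 'I_m].
  apply/setP=> a; rewrite inE; apply/eqP/imsetP => [/(prim_rootP pz)[i ->]|[i _ ->]].
    by exists i.
  by rewrite exprAC (prim_expr_order pz) expr1n.
rewrite card_imset ?card_ord // => i j /eqP.
by rewrite (eq_prim_root_expr pz) !modn_small // => /eqP/val_inj.
Qed.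

(** A nonempty fiber is a coset of the group of m-th roots of unity. *)
Lemma card_power_fiber m (s : F) : (m %| #|F|.-1)%N -> s != 0 ->
  (m %| #|[set x | x ^+ m == s]|)%N.
Proof.
move=> dm s0; have lt1F : (1 < #|F|)%N by apply: finNzRing_gt1.
have m0 : (0 < m)%N by apply: dvdn_gt0 dm; lia.
have [->|[x0]] := set_0Vmem [set x | x ^+ m == s]; first by rewrite cards0 dvdn0.
rewrite inE => /eqP x0s; have x00 : x0 != 0.
  by apply: contraNneq s0 => x00; rewrite -x0s x00 expr0n gtn_eqF.
rewrite -{1}(card_unity_roots dm) -(card_imset _ (mulfI x00)).
rewrite (_ : [set x | x ^+ m == s] = [set x0 * a | a in [set a | a ^+ m == 1]]) //.
apply/setP=> x; rewrite inE; apply/eqP/imsetP => [xs|[a]].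
  exists (x / x0); last by rewrite mulrC divfK.
  by rewrite inE expr_div_n xs x0s divff.
by rewrite inE => /eqP a1 ->; rewrite exprMn a1 mulr1.
Qed.

Lemma card_roots_le (P : {poly F}) d : P != 0 -> (size P <= d.+1)%N ->
  (#|[set x | root P x]| <= d)%N.
Proof.
move=> P0 sP; rewrite -ltnS (leq_trans _ sP) // cardE.
apply: max_poly_roots => //; last exact: enum_uniq.
by apply/allP=> x; rewrite mem_enum inE.
Qed.

End RootsOfUnity.

Section Additive.
Variables (F : finZmodType) (f : F -> F).
Hypothesis fB : {morph f : x y / x - y}.

Lemma card_additive_fiber x0 :
  #|[set x | f x == f x0]| = #|[set x | f x == 0]|.
Proof.
rewrite -[RHS](card_imset _ (addrI x0)); congr #|pred_of_set _|.
apply/setP=> x; rewrite inE.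
apply/eqP/imsetP => [e|[y]].
  by exists (x - x0); rewrite ?inE ?fB ?e ?subrr // addrC subrK.
rewrite inE => /eqP fy ->; have f0 : f 0 = 0 by have := fB 0 0; rewrite !subrr.
have -> : x0 + y = x0 - (0 - y) by rewrite sub0r opprK.
by rewrite !fB fy f0 !subr0.
Qed.

Lemma card_additive_image :
  (#|[set x | f x == 0%R]| * #|f @: setT|)%N = #|F|.
Proof.
rewrite -cardsT -[RHS]sum1_card (partition_big_imset f) /=.
rewrite mulnC -sum_nat_const; apply: eq_bigr => _ /imsetP[x0 _ ->].
rewrite -(card_additive_fiber x0) -sum1_card.
by apply: eq_bigl => x; rewrite !inE.
Qed.

End Additive.

(** * The Hermitian form on a field of even degree *)

Lemma Posz_exp (a b : nat) : Posz (a ^ b) = a%:Z ^+ b.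
Proof. by rewrite -!natz natrX. Qed.

(** The shape in which the moment equations of the Hermitian form determine
    the size [a] of its zero level. Here [M] is the common size of the nonzero
    levels; the first two equations say that the deviation [Q - M] has the
    same square as [B], where [B] stands for (-q)^n, so [Q - M] is [B] or
    [- B]. Modulo [q + 1] one has [B = 1], [Q = - 1] and [M = 0], so
    [Q - M = B] would make [q + 1] a divisor of 2. *)
Lemma level_equations_sol (q Q M m a m1 m2 B : int) : 1 < q -> q * Q = a + (q - 1) * M ->
  (q * Q - q ^+ 2) * Q + q ^+ 2 * (q * Q) = a ^+ 2 + (q - 1) * M ^+ 2 ->
  B = 1 - (q + 1) * m1 -> Q = (q + 1) * m2 - 1 -> B ^+ 2 = q * Q ->
  M = m * (q + 1) -> a = Q - (q - 1) * B.
Proof.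
move=> q1 e1 e2 E1 E2 E3 eM.
have ea : a = q * Q - (q - 1) * M by rewrite e1; ring.
have : (q - 1) * q * ((Q - M - B) * (Q - M + B)) = 0.
  rewrite (_ : _ * (_ * _) = (q - 1) * q * ((Q - M) ^+ 2 - B ^+ 2)); last by ring.
  rewrite E3; move/eqP: e2; rewrite ea -subr_eq0 => /eqP e2.
  by rewrite -[RHS]oppr0 -e2; ring.
move/eqP; rewrite !mulf_eq0 => /orP[/orP[]|/orP[]] /eqP e.
- by clear -e q1; lia.
- by clear -e q1; lia.
- have e3 : (q + 1) * (m1 + m2 - m) = 2 by rewrite mulrBr mulrDr (mulrC _ m) -eM; lra.
  move: e3 q1; move: (m1 + m2 - m) => t et q1.
  have q2 : 0 < q + 1 by lia.
  have [h|h] : t <= 0 \/ 1 <= t by clear; lia.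
    by move: h; rewrite -(pmulr_rle0 _ q2) et.
  by move: h; rewrite -(ler_pM2l q2) et; clear -q1; lia.
- by rewrite ea (_ : M = Q + B); [ring | lra].
Qed.

Section HermitianForm.
Variables (F : finFieldType) (p k n : nat).
Hypotheses (pF : p \in [pchar F]) (k_gt0 : (0 < k)%N) (n_gt0 : (0 < n)%N).
Local Notation q := (p ^ k)%N.
Hypothesis cardF : #|F| = (q ^ (2 * n))%N.
Local Notation Q := (q ^ (2 * n).-1)%N.

Lemma q_gt1 : (1 < q)%N.
Proof. by rewrite -[1%N](exp1n k) ltn_exp2r ?prime_gt1 // (pcharf_prime pF). Qed.

Lemma cardF_qQ : #|F| = (q * Q)%N.
Proof. by rewrite cardF -expnS prednK //; lia. Qed.

Lemma q_pcharnat i : [pchar F].-nat (q ^ i)%N.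
Proof. by rewrite -expnM pnatX pnatE ?(pcharf_prime pF) // pF. Qed.

Lemma frobB i : {morph (fun x : F => x ^+ (q ^ i)) : x y / x - y}.
Proof.
by move=> x y /=; rewrite exprDn_pchar ?q_pcharnat // exprNn_pchar ?q_pcharnat.
Qed.

Lemma frobD i : {morph (fun x : F => x ^+ (q ^ i)) : x y / x + y}.
Proof. by move=> x y /=; rewrite exprDn_pchar ?q_pcharnat. Qed.

(** The left-hand side of the equation of the curve. *)
Definition frob_plus_id (y : F) := y ^+ q + y.

(** The alternating sum that telescopes against y^q + y: because the number of
    terms is even and z^(q^(2n)) = z, each of the two maps kills the image of
    the other. *)
Definition alt_trace (z : F) := \sum_(i < 2 * n) (-1) ^+ i * z ^+ (q ^ i).

Local Notation phi := frob_plus_id.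
Local Notation T := alt_trace.

Lemma frob_plus_idB : {morph phi : x y / x - y}.
Proof. by move=> x y; rewrite /phi (frobB 1); ring. Qed.

Lemma alt_traceB : {morph T : x y / x - y}.
Proof.
move=> x y; rewrite /T -sumrB; apply: eq_bigr => i _.
by rewrite frobB mulrBr.
Qed.

Lemma alt_traceD : {morph T : x y / x + y}.
Proof.
by move=> x y; rewrite /T -big_split; apply: eq_bigr => i _; rewrite frobD mulrDr.
Qed.

Lemma alt_traceXq z : T z ^+ q = T (z ^+ q).
Proof.
rewrite /T; elim/big_rec2: _ => [|i a b _ IH]; first by rewrite expr0n gtn_eqF ?(ltnW q_gt1).
rewrite (frobD 1) IH; congr (_ + _).
rewrite /= expn1 exprMn; congr (_ * _); last by rewrite exprAC.
by rewrite exprAC -{1}(expn1 q) exprNn_pchar ?q_pcharnat // expr1n.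
Qed.

Lemma frob_plus_id_alt_trace z : phi (T z) = 0.
Proof.
rewrite /phi alt_traceXq.
suff -> : T (z ^+ q) = - T z by rewrite addNr.
have -> : T (z ^+ q) = \sum_(i < 2 * n) (-1) ^+ i * z ^+ (q ^ i.+1).
  by apply: eq_bigr => i _; rewrite -exprM -expnS.
have e : \sum_(i < (2 * n).+1) (-1) ^+ i * z ^+ (q ^ i) = T z + z.
  by rewrite big_ord_recr /= -cardF expf_card exprM sqrrN !expr1n mul1r.
rewrite big_ord_recl expr0 mul1r expr1 addrC in e.
move/addIr: e => <-; rewrite -sumrN; apply: eq_bigr => i _ /=.
by rewrite exprS !mulN1r mulNr opprK.
Qed.

Lemma alt_trace_frob z : T (z ^+ q) = - T z.
Proof.
by rewrite -alt_traceXq; apply/eqP; rewrite -addr_eq0; apply/eqP/frob_plus_id_alt_trace.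
Qed.

Lemma alt_trace_frob_plus_id z : T (phi z) = 0.
Proof. by rewrite /phi alt_traceD alt_trace_frob addNr. Qed.

Definition ker_frob_plus_id := [set y : F | phi y == 0].
Local Notation K := ker_frob_plus_id.

Lemma card_ker_frob_plus_id_le : (#|K| <= q)%N.
Proof.
have sP : size ('X^q + 'X : {poly F}) = q.+1.
  by rewrite size_polyDl ?size_polyXn // size_polyX ltnS q_gt1.
apply: leq_trans (card_roots_le (P := 'X^q + 'X) (d := q) _ _).
- by apply/subset_leq_card/subsetP=> x; rewrite !inE rootE !hornerE.
- by rewrite -size_poly_eq0 sP.
- by rewrite sP.
Qed.

Lemma card_ker_alt_trace_le : (#|[set z | T z == 0%R]| <= Q)%N.
Proof.
pose P : {poly F} := \sum_(i < 2 * n) (-1) ^+ i *: 'X^(q ^ i).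
apply: leq_trans (card_roots_le (P := P) (d := Q) _ _).
- apply/subset_leq_card/subsetP=> x; rewrite !inE rootE horner_sum => /eqP Tx.
  by apply/eqP; rewrite -[RHS]Tx; apply: eq_bigr => i _; rewrite !hornerE.
- (* The coefficient of 'X is 1. *)
  apply: contraTneq (oner_neq0 F) => P0.
  have := congr1 (fun R : {poly F} => R`_1) P0; rewrite coef0 /P.
  have [m em] : exists m, (2 * n = m.+1)%N by exists (2 * n).-1; lia.
  rewrite em coef_sum big_ord_recl !coefE expr0 mul1r big1 ?addr0.
    by move/eqP; rewrite negbK.
  move=> i _; rewrite !coefE ltn_eqF ?mulr0 // lift0 expnS.
  by rewrite (leq_trans q_gt1) // leq_pmulr // expn_gt0 (ltnW q_gt1).
- apply: leq_trans (size_sum _ _ _) _; apply/bigmax_leqP => i _.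
  apply: leq_trans (size_scale_leq _ _) _; rewrite size_polyXn ltnS.
  by rewrite leq_pexp2l ?(ltnW q_gt1) //; have := ltn_ord i; lia.
Qed.

Lemma im_alt_trace_sub : T @: setT \subset K.
Proof. by apply/subsetP=> _ /imsetP[z _ ->]; rewrite inE frob_plus_id_alt_trace. Qed.

Lemma im_frob_plus_id_sub : phi @: setT \subset [set z | T z == 0].
Proof. by apply/subsetP=> _ /imsetP[z _ ->]; rewrite inE alt_trace_frob_plus_id. Qed.

(** Both images lie in the kernel of the other map, and the degrees of the two
    polynomials bound the kernels by [q] and [Q]. As kernel and image sizes
    multiply to [q * Q], no inequality can be strict. *)
Lemma card_ker_im : [/\ #|K| = q, #|[set z | T z == 0]| = Q,
  T @: setT = K & phi @: setT = [set z | T z == 0]].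
Proof.
have c1 := card_additive_image frob_plus_idB; have c2 := card_additive_image alt_traceB.
have l1 := subset_leq_card im_alt_trace_sub; have l2 := subset_leq_card im_frob_plus_id_sub.
have l3 := card_ker_frob_plus_id_le; have l4 := card_ker_alt_trace_le.
rewrite -/K cardF_qQ in c1; rewrite cardF_qQ in c2.
have q0 := q_gt1; have Q0 : (0 < Q)%N by rewrite expn_gt0 (ltnW q0).
have i1 : (Q <= #|phi @: setT|)%N.
  by rewrite -(leq_pmul2l (ltnW q0)) -c1 leq_mul2r l3 orbT.
have i2 : (q <= #|T @: setT|)%N.
  by rewrite -(leq_pmul2r Q0) -c2 mulnC leq_mul2l l4 orbT.
have e1 : #|K| = q by apply/eqP; rewrite eqn_leq l3 (leq_trans i2).
have e2 : #|[set z | T z == 0]| = Q by apply/eqP; rewrite eqn_leq l4 (leq_trans i1).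
split=> //; apply/eqP; rewrite eqEcard.
  by rewrite im_alt_trace_sub e1.
by rewrite im_frob_plus_id_sub e2.
Qed.

Lemma card_alt_trace_fiber c : c \in K -> #|[set z | T z == c]| = Q.
Proof.
have [_ <- <- _] := card_ker_im => /imsetP[z _ ->].
exact: card_additive_fiber alt_traceB z.
Qed.

Lemma card_frob_plus_id_fiber c : #|[set y | phi y == c]| = (q * (T c == 0%R))%N.
Proof.
have [eK _ _ eI] := card_ker_im.
have [Tc|Tc] := boolP (T c == 0).
  have : c \in phi @: setT by rewrite eI inE.
  by case/imsetP=> y _ ->; rewrite (card_additive_fiber frob_plus_idB) -/K eK muln1.
rewrite muln0; apply/eqP; rewrite cards_eq0; apply/eqP/setP=> y; rewrite !inE.
by apply: contraNF Tc => /eqP <-; rewrite alt_trace_frob_plus_id.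
Qed.

Lemma alt_trace0 : T 0 = 0.
Proof. by have := alt_traceB 0 0; rewrite !subrr. Qed.

Lemma q2_predE : (q ^ 2).-1 = (q.-1 * q.+1)%N.
Proof. by have := q_gt1; move: q => r; nia. Qed.

Lemma q2_pred_dvd : ((q ^ 2).-1 %| #|F|.-1)%N.
Proof. by rewrite cardF expnM dvdn_pred_predX. Qed.

(** The norm from the field with q^2 elements onto the field with q elements:
    both unit groups are generated by powers of a primitive element of [F]. *)
Lemma norm_surj (s : F) : s != 0 -> s ^+ q = s -> exists a, a ^+ q.+1 = s.
Proof.
move=> s0 sq; have q1 := q_gt1; have lt1F := finNzRing_gt1 F.
have [g pg] := finField_prim_root F.
have s1 : s ^+ q.-1 = 1.
  by apply: (mulfI s0); rewrite -exprS prednK ?(ltnW q1) // sq mulr1.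
have d1 : (q.-1 %| #|F|.-1)%N.
  by apply: dvdn_trans q2_pred_dvd; rewrite q2_predE dvdn_mulr.
have [i ->] := prim_rootP (dvdn_prim_root pg d1) s1.
have /dvdnP[c ec] := q2_pred_dvd.
exists (g ^+ (c * i)); rewrite -!exprM; congr (_ ^+ _).
by rewrite ec q2_predE (mulnC q.-1) mulnA mulnK; [ring | lia].
Qed.

Lemma alt_traceZ s z : s ^+ q = s -> T (s * z) = s * T z.
Proof.
move=> sq; rewrite /T mulr_sumr; apply: eq_bigr => i _.
suff -> : (s * z) ^+ (q ^ i) = s * z ^+ (q ^ i) by rewrite mulrCA.
rewrite exprMn; congr (_ * _); elim: (nat_of_ord i) => // j IH.
by rewrite expnS exprM sq.
Qed.

(** A point of the curve lies above [x] exactly when this form vanishes at [x].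
    It is a Hermitian form over the subfield with q^2 elements, whose radical
    is that subfield. *)
Definition herm_form (x : F) := T (x ^+ q.+1).
Local Notation h := herm_form.
Definition level_card c := #|[set x | h x == c]|.
Local Notation N := level_card.

Lemma herm_formM a x : (a ^+ q.+1) ^+ q = a ^+ q.+1 -> h (a * x) = a ^+ q.+1 * h x.
Proof. by move=> aq; rewrite /h exprMn alt_traceZ. Qed.

(** Scaling by an element of prescribed norm carries one level set to another. *)
Lemma level_card_eq c c' : c \in K -> c' \in K -> c != 0 -> c' != 0 -> N c = N c'.
Proof.
rewrite !inE /phi !addr_eq0 => /eqP cq /eqP cq' c0 c0'.
have s0 : c' / c != 0 by rewrite mulf_neq0 ?invr_eq0.
have sq : (c' / c) ^+ q = c' / c by rewrite expr_div_n cq cq' invrN mulrNN.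
have [a ea] := norm_surj s0 sq.
have a0 : a != 0 by apply: contraNneq s0 => a0; rewrite -ea a0 expr0n.
rewrite /N -(card_imset _ (mulfI a0)); congr #|pred_of_set _|.
apply/setP=> y; rewrite [RHS]inE; apply/imsetP/eqP => [[x]|hy].
  by rewrite inE => /eqP hx ->; rewrite herm_formM ea ?sq // hx divfK.
exists (y / a); last by rewrite mulrC divfK.
have : h (a * (y / a)) = c' by rewrite mulrC divfK.
rewrite herm_formM ea ?sq // inE => /(canRL (mulKf s0)) ->.
by rewrite invf_div divfK.
Qed.

(** The value at [x] depends on x^(q+1) only, so a nonzero level is a union of
    fibers of the power map, each of which has q + 1 elements. *)
Lemma level_card_dvd c : c != 0 -> (q.+1 %| N c)%N.
Proof.
move=> c0.
have dq : (q.+1 %| #|F|.-1)%N by apply: dvdn_trans q2_pred_dvd; rewrite q2_predE dvdn_mull.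
rewrite /N -sum1_card (partition_big_imset (fun x => x ^+ q.+1)) /=.
apply: dvdn_sum => s /imsetP[x0]; rewrite inE => /eqP hx0 -> {s}.
have s0 : x0 ^+ q.+1 != 0.
  by apply: contraNneq c0 => x00; rewrite -hx0 /h x00 alt_trace0 eqxx.
rewrite (_ : \sum_(_ in _ | _) _ = #|[set x | x ^+ q.+1 == x0 ^+ q.+1]|)%N.
  exact: card_power_fiber.
rewrite -sum1_card; apply: eq_bigl => x; rewrite !inE.
by case: (x ^+ _ =P _) => [e|]; rewrite ?andbF // andbT /h e -hx0 eqxx.
Qed.

(** The polar form simplifies because T(u^q x) = - T(u^(q^2) x^q): it becomes a
    single value of [T] at a bijective function of [x], unless [u] is fixed by
    the q^2-power map. *)
Lemma herm_formD x u : h (x + u) = h x + h u + T ((u - u ^+ (q ^ 2)) * x ^+ q).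
Proof.
rewrite /h mulrBl alt_traceB -[u ^+ (q ^ 2)]/(u ^+ (q * q)) exprM -(exprMn _ (u ^+ q)).
rewrite alt_trace_frob opprK -!alt_traceD; congr T; rewrite !exprS.
rewrite (_ : (x + u) ^+ q = x ^+ q + u ^+ q); last exact: (frobD 1).
by ring.
Qed.

(** For such [u] the norm u^(q+1) is fixed by the q-power map, and the
    alternating sum of an even number of equal terms vanishes. *)
Lemma herm_form_fixed u : u ^+ (q ^ 2) = u -> h u = 0.
Proof.
move=> uq; have sq : (u ^+ q.+1) ^+ q = u ^+ q.+1.
  by rewrite -exprM mulSn exprD -[(q * q)%N]/(q ^ 2)%N uq mulrC -exprS.
have T1 : T 1 = 0.
  rewrite /T (eq_bigr (fun i : 'I_(2 * n) => (-1) ^+ i)); last first.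
    by move=> i _; rewrite expr1n mulr1.
  have alt m : \sum_(i < m * 2) (-1) ^+ i = 0 :> F.
    elim: m => [|m IH]; first by rewrite big_ord0.
    by rewrite mulSn !big_ord_recr /= IH exprS mulN1r add0r subrr.
  by rewrite mulnC alt.
by rewrite /h -[_ ^+ _]mulr1 alt_traceZ // T1 mulr0.
Qed.

Lemma card_herm_form_shift u :
  #|[set x | h (x + u) == h x]| = if u ^+ (q ^ 2) == u then #|F| else Q.
Proof.
case: eqP => [e|/eqP ne].
  rewrite -cardsT; congr #|pred_of_set _|; apply/setP=> x.
  rewrite !inE herm_formD (herm_form_fixed e).
  by rewrite e subrr mul0r alt_trace0 !addr0 eqxx.
have d0 : u - u ^+ (q ^ 2) != 0 by rewrite subr_eq0 eq_sym.
have injx : injective (fun x => (u - u ^+ (q ^ 2)) * x ^+ q).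
  move=> x y /(mulfI d0)/eqP; rewrite -subr_eq0 -[q]expn1 -frobB.
  by rewrite expf_eq0 subr_eq0 => /andP[_ /eqP].
have <- : #|[set z | T z == - h u]| = Q.
  by apply: card_alt_trace_fiber; rewrite inE -alt_trace_frob frob_plus_id_alt_trace.
rewrite -(card_imset _ injx); congr #|pred_of_set _|.
apply/setP=> z; rewrite [RHS]inE; apply/imsetP/eqP => [[x]|Tz].
  rewrite inE herm_formD -subr_eq0 => /eqP e ->; apply/eqP; rewrite -addr_eq0.
  by apply/eqP; rewrite -e; ring.
have [f' fK f'K] := injF_bij injx.
exists (f' z); last by rewrite f'K.
by rewrite inE herm_formD f'K Tz addrK.
Qed.

Lemma card_fixed_frob2 : #|[set u : F | u ^+ (q ^ 2) == u]| = (q ^ 2)%N.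
Proof.
have q20 : (0 < q ^ 2)%N by rewrite expn_gt0 (ltnW q_gt1).
have q21 : (0 < (q ^ 2).-1)%N by have := q_gt1; move: q => r; nia.
rewrite (cardsD1 0) inE expr0n gtn_eqF // eqxx -[RHS](prednK q20) add1n.
rewrite -(card_unity_roots q2_pred_dvd); congr #|pred_of_set _|.+1.
apply/setP=> u; rewrite !inE -{1}(prednK q20) exprS.
have [->|u0] := eqVneq u 0; first by rewrite expr0n (gtn_eqF q21) [RHS]eq_sym oner_eq0.
by rewrite -[X in _ == X]mulr1 (inj_eq (mulfI u0)).
Qed.

(** Counting the pairs with equal values of the form by their difference [u]. *)
Lemma second_moment :
  (\sum_x N (h x) = (#|F| - q ^ 2) * Q + q ^ 2 * #|F|)%N.
Proof.
transitivity (\sum_u #|[set x | h (x + u)%R == h x]|)%N.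
  under eq_bigr => x _ do rewrite /N -sum1_card big_mkcond (reindex_inj (addrI x)) /=.
  rewrite exchange_big; apply: eq_bigr => u _; rewrite -sum1_card [RHS]big_mkcond /=.
  by apply: eq_bigr => x _; rewrite !inE.
under eq_bigr => u _ do rewrite card_herm_form_shift.
rewrite (bigID (fun u => u ^+ (q ^ 2) == u)) /= addnC; congr (_ + _)%N.
  rewrite (eq_bigr (fun=> Q)) => [|u /negPf -> //].
  rewrite sum_nat_const; congr (_ * _)%N.
  rewrite -(cardsC [set u : F | u ^+ (q ^ 2) == u]) card_fixed_frob2 addKn.
  by apply: eq_card => u; rewrite !inE.
rewrite (eq_bigr (fun=> #|F|)) => [|u ->] //.
rewrite sum_nat_const; congr (_ * _)%N; rewrite -[RHS]card_fixed_frob2.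
by apply: eq_card => u; rewrite !inE.
Qed.

Lemma mem0_ker_frob_plus_id : 0 \in K.
Proof. by rewrite inE -{1}alt_trace0 frob_plus_id_alt_trace. Qed.

Lemma level_card_const : exists2 M : nat,
  (q.+1 %| M)%N & forall c, c \in K -> c != 0 -> N c = M.
Proof.
have [eK _ _ _] := card_ker_im.
have : (1 < #|K|)%N by rewrite eK q_gt1.
rewrite (cardsD1 0) mem0_ker_frob_plus_id add1n ltnS => /card_gt0P[c].
rewrite in_setD1 => /andP[c0 cK]; exists (N c); first exact: level_card_dvd.
by move=> c' cK' c0'; apply: level_card_eq.
Qed.

(** Used with [g = 1], where it counts [F], and with [g = N], where it computes
    the second moment. *)
Lemma sum_levels M t (g : F -> nat) :
  (forall c, c \in K -> c != 0 -> N c = M /\ g c = t) ->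
  (\sum_x g (h x) = N 0%R * g 0%R + q.-1 * (M * t))%N.
Proof.
move=> NE; have [eK _ _ _] := card_ker_im.
rewrite (partition_big h (mem K)) => [|x _] /=; last by rewrite inE frob_plus_id_alt_trace.
have fib c : (\sum_(x | h x == c) g (h x) = N c * g c)%N.
  rewrite (eq_bigr (fun=> g c)) => [|x /eqP -> //]; rewrite sum_nat_const.
  by congr (_ * _)%N; apply: eq_card => x; rewrite !inE.
rewrite (bigD1 0) ?mem0_ker_frob_plus_id //= fib; congr (_ + _)%N.
rewrite (eq_bigr (fun=> M * t)%N) => [|c /andP[cK c0]]; last first.
  by have [<- <-] := NE c cK c0; rewrite fib.
rewrite sum_nat_const -eK (cardsD1 0) mem0_ker_frob_plus_id add1n /=; congr (_ * _)%N.
by apply: eq_card => c; rewrite in_setD1 andbC.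
Qed.

Lemma level_zero_card :
  (N 0)%:Z = (Q%:Z - (q%:Z - 1) * (- q%:Z) ^+ n)%R.
Proof.
have [M dM NM] := level_card_const; have q1 := q_gt1.
have e1 : (q * Q = N 0%R + q.-1 * M)%N.
  have := @sum_levels M 1%N (fun=> 1%N); rewrite sum1_card cardF_qQ !muln1 => -> //.
  by move=> c cK c0; rewrite (NM c).
have e2 : ((q * Q - q ^ 2) * Q + q ^ 2 * (q * Q) = N 0%R * N 0%R + q.-1 * (M * M))%N.
  by rewrite -cardF_qQ -second_moment; apply: sum_levels => c cK c0; rewrite (NM c).
have leQ : (q ^ 2 <= q * Q)%N by rewrite -cardF_qQ cardF leq_pexp2l //; lia.
have [m1 E1] : exists m, (- q%:Z) ^+ n = 1 - (q%:Z + 1) * m.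
  exists (\sum_(i < n) (- q%:Z) ^+ i); by rewrite -[LHS](subrK 1) subrX1; ring.
have [m2 E2] : exists m, Q%:Z = (q%:Z + 1) * m - 1.
  exists (\sum_(i < (2 * n).-1) (- q%:Z) ^+ i).
  have -> : Q%:Z = - (- q%:Z) ^+ (2 * n).-1.
    by rewrite exprNn -signr_odd (_ : odd _ = true) ?mulN1r ?opprK ?Posz_exp //; lia.
  by rewrite -[X in - X](subrK 1) subrX1; ring.
have E3 : ((- q%:Z) ^+ n) ^+ 2 = q%:Z * Q%:Z.
  by rewrite -exprM mulnC exprM sqrrN -exprM -PoszM -cardF_qQ cardF (Posz_exp q).
have /dvdnP[m eM] := dM.
have {e1} e1 : q%:Z * Q%:Z = (N 0)%:Z + (q%:Z - 1) * M%:Z.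
  have -> : q%:Z - 1 = Posz q.-1 by clear -q1; lia.
  by rewrite -!PoszM -PoszD e1.
have {e2} e2 : (q%:Z * Q%:Z - q%:Z ^+ 2) * Q%:Z + q%:Z ^+ 2 * (q%:Z * Q%:Z)
    = (N 0)%:Z ^+ 2 + (q%:Z - 1) * M%:Z ^+ 2.
  have -> : q%:Z * Q%:Z - q%:Z ^+ 2 = Posz (q * Q - q ^ 2).
    by rewrite -subzn // PoszM (Posz_exp q).
  have -> : q%:Z - 1 = Posz q.-1 by clear -q1; lia.
  by rewrite -(Posz_exp q) !expr2 -!PoszM -!PoszD e2.
have {}eM : M%:Z = m%:Z * (q%:Z + 1) by rewrite eM PoszM -addn1 PoszD.
have {}q1 : 1 < q%:Z by rewrite ltz_nat.
exact: (level_equations_sol q1 e1 e2 E1 E2 E3 eM).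
Qed.
Lemma card_hermitian_affine :
  (#|[set P : F * F | P.2 ^+ q + P.2 == P.1 ^+ q.+1]|)%:Z
    = q%:Z ^+ (2 * n) - q%:Z * (q%:Z - 1) * (- q%:Z) ^+ n.
Proof.
have -> : #|[set P : F * F | P.2 ^+ q + P.2 == P.1 ^+ q.+1]|
    = (q * N 0%R)%N.
  rewrite -sum1_card (eq_bigl (fun P : F * F => P.2 ^+ q + P.2 == P.1 ^+ q.+1)); last first.
    by move=> P; rewrite inE.
  rewrite -(pair_big_dep xpredT (fun x y => y ^+ q + y == x ^+ q.+1) (fun _ _ => 1%N)) /=.
  rewrite /N -sum1_card big_distrr /= [RHS]big_mkcond /=.
  apply: eq_bigr => x _; rewrite inE muln1.
  transitivity #|[set y | phi y == x ^+ q.+1]|.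
    by rewrite -sum1_card; apply: eq_bigl => y; rewrite inE.
  by rewrite card_frob_plus_id_fiber /h; case: eqP; rewrite ?muln1 ?muln0.
rewrite PoszM level_zero_card mulrBr -PoszM -cardF_qQ.
by rewrite cardF (Posz_exp q); ring.
Qed.

End HermitianForm.

(** * Points of the projective curve *)

Section Projective.
Variables (F : finFieldType) (p k : nat).
Hypothesis p_gt0 : (0 < p)%N.
Local Notation q := (p ^ k)%N.

Definition vec3 (x y z : F) : 'rV[F]_3 :=
  \row_(i < 3) [:: x; y; z]`_i.

Lemma xcoord_vec3 x y z : xcoord (vec3 x y z) = x.
Proof. by rewrite /xcoord mxE inordK. Qed.
Lemma ycoord_vec3 x y z : ycoord (vec3 x y z) = y.
Proof. by rewrite /ycoord mxE inordK. Qed.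
Lemma zcoord_vec3 x y z : zcoord (vec3 x y z) = z.
Proof. by rewrite /zcoord mxE inordK. Qed.
Definition coordE := (xcoord_vec3, ycoord_vec3, zcoord_vec3).

Lemma vec3_coord v : v = vec3 (xcoord v) (ycoord v) (zcoord v).
Proof.
apply/rowP=> i; rewrite mxE /xcoord /ycoord /zcoord.
by case: i => [[|[|[|//]]]] lt; congr (v _ _); apply/val_inj; rewrite /= inordK.
Qed.

Lemma scale_vec3 a x y z : a *: vec3 x y z = vec3 (a * x) (a * y) (a * z).
Proof. by apply/rowP=> i; rewrite !mxE; case: i => [[|[|[|//]]]] lt. Qed.

Lemma vec3_eq0 x y z : (vec3 x y z == 0) = [&& x == 0, y == 0 & z == 0].
Proof.
apply/eqP/and3P => [e|[/eqP-> /eqP-> /eqP->]].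
  have [] := (congr1 (@xcoord F) e, congr1 (@ycoord F) e); move: (congr1 (@zcoord F) e).
  by rewrite !coordE /xcoord /ycoord /zcoord !mxE => -> -> ->.
by apply/rowP=> i; rewrite !mxE; case: i => [[|[|[|//]]]].
Qed.

Lemma line_throughZ a (v : 'rV[F]_3) : a != 0 -> line_through (a *: v) = line_through v.
Proof.
move=> a0; apply/setP=> w; apply/imsetP/imsetP => [[b _ ->]|[b _ ->]].
  by exists (b * a); rewrite // scalerA.
by exists (b / a); rewrite // scalerA divfK.
Qed.

Lemma line_through_refl (v : 'rV[F]_3) : v \in line_through v.
Proof. by apply/imsetP; exists 1; rewrite // scale1r. Qed.

(** On the line z = 0 the equation forces x = 0, which leaves one point. *)
Lemma hermitian_points_affine :
  hermitian_points p k F = line_through (vec3 0 1 0) |: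
    [set line_through (vec3 P.1 P.2 1) | P in
       [set P : F * F | P.2 ^+ q + P.2 == P.1 ^+ q.+1]].
Proof.
have q_gt0 : (0 < q)%N by rewrite expn_gt0 p_gt0.
apply/setP=> A; rewrite !inE; apply/imsetP/orP => [[v]|].
  rewrite inE (vec3_coord v); move: (xcoord v) (ycoord v) (zcoord v) => x y z.
  rewrite vec3_eq0 /on_hermitian !coordE => /andP[v0 /eqP e] ->.
  have [z0|z0] := eqVneq z 0.
    left; move: e v0; rewrite z0 expr0n gtn_eqF // !mulr0 addr0 eqxx andbT.
    move/esym/eqP; rewrite expf_eq0 /= => /eqP ->; rewrite eqxx /= => y0.
    by rewrite -(line_throughZ (vec3 0 1 0) y0) scale_vec3 !mulr0 mulr1.
  right; apply/imsetP; exists (x / z, y / z).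
    rewrite inE /= !expr_div_n -e; apply/eqP.
    by rewrite exprS; field; rewrite z0 expf_neq0.
  rewrite -(line_throughZ (vec3 _ _ 1) z0) scale_vec3 /= mulr1.
  by rewrite !(mulrC z) !divfK.
case=> [/eqP ->|/imsetP[[x y]]].
  exists (vec3 0 1 0) => //; rewrite inE vec3_eq0 oner_eq0 andbF /on_hermitian !coordE.
  by rewrite !expr0n gtn_eqF //= !mulr0 addr0.
rewrite inE /= => /eqP e ->; exists (vec3 x y 1) => //.
by rewrite inE vec3_eq0 oner_eq0 !andbF /on_hermitian !coordE expr1n !mulr1 e /=.
Qed.

Lemma card_hermitian_points :
  #|hermitian_points p k F| =
    (#|[set P : F * F | (P.2 ^+ q + P.2 == P.1 ^+ q.+1)%R]|).+1.
Proof.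
rewrite hermitian_points_affine cardsU1 card_in_imset; last first.
  case=> x y [x' y'] _ _ /= e.
  have := line_through_refl (vec3 x y 1); rewrite e => /imsetP[a _].
  rewrite scale_vec3 mulr1 => e'; have := congr1 (@zcoord F) e'.
  have := congr1 (@ycoord F) e'; have := congr1 (@xcoord F) e'.
  by rewrite !coordE => -> -> <-; rewrite !mul1r.
rewrite (_ : _ \notin _) //; apply/imsetP=> [[P _ e]].
have := line_through_refl (vec3 0 1 0); rewrite e => /imsetP[a _].
rewrite scale_vec3 mulr1 => e'; have := congr1 (@zcoord F) e'.
have := congr1 (@ycoord F) e'; rewrite !coordE => e1 /esym a0.
by move/eqP: e1; rewrite a0 mul0r oner_eq0.
Qed.

End Projective.

(** The curve is maximal over the field with q^2 elements, and this count says
    that its Frobenius eigenvalues over that field are q(q - 1) times - q. *)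
Lemma hermitian_countE p (pr_p : prime p) k m : (0 < k)%N ->
  (hermitian_count pr_p k (2 * k * m.+1).-1)%:Z =
    (p ^ (2 * k * m.+1))%:Z + 1
    - ((p ^ k)%:Z * ((p ^ k)%:Z - 1) * (- (p ^ k)%:Z) ^+ m.+1).
Proof.
move=> k0; rewrite /hermitian_count card_hermitian_points ?prime_gt0 //.
have e : #|gf pr_p (2 * k * m.+1).-1| = ((p ^ k) ^ (2 * m.+1))%N.
  by rewrite card_gf prednK; [rewrite -expnM; congr (_ ^ _)%N; ring | lia].
have pF : p \in [pchar gf pr_p (2 * k * m.+1).-1].
  exact: (s2valP (pPrimePowerField pr_p (ltn0Sn (2 * k * m.+1).-1))).
rewrite -addn1 PoszD (card_hermitian_affine pF k0 _ e) //.
rewrite (_ : (p ^ (2 * k * m.+1))%N = ((p ^ k) ^ (2 * m.+1))%N).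
  by rewrite (Posz_exp (p ^ k)); ring.
by rewrite -expnM; congr (_ ^ _)%N; ring.
Qed.

(** * From the exponential series to power sums of reciprocal roots *)

Section Truncation.
Variable K : fieldType.
Implicit Types (P Q : {poly K}) (f : nat -> K).

Lemma dvdXnP n P : reflect (forall i, (i < n)%N -> P`_i = 0) ('X^n %| P).
Proof.
apply: (iffP idP) => [/dvdpP[Q ->] i lin|P0]; first by rewrite coefMXn lin.
rewrite -(poly_take_drop n P) dvdp_addl ?dvdp_mull // (_ : take_poly n P = 0) ?dvdp0 //.
by apply/polyP=> i; rewrite coef_take_poly coef0; case: ifP => // /P0.
Qed.

Lemma dvdXn_deriv n P : ('X^(n.+1) %| P) -> ('X^n %| P^`())%R.
Proof. by move=> /dvdXnP P0; apply/dvdXnP=> i lin; rewrite coef_deriv P0 ?mul0rn. Qed.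

Lemma dvdX_exp n P Q j : ('X^n %| P - Q) -> ('X^n %| P ^+ j - Q ^+ j)%R.
Proof. by move=> d; rewrite subrXX dvdp_mulr. Qed.

Definition trunc n f : {poly K} := \poly_(i < n.+1) f i.

Lemma dvdX_trunc n f : f 0%N = 0 -> ('X %| trunc n f)%R.
Proof. by move=> f0; rewrite -['X]expr1; apply/dvdXnP => -[|//] _; rewrite coef_poly. Qed.

Lemma dvdX_trunc_sub m n f : (m <= n)%N -> ('X^(m.+1) %| trunc n f - trunc m f)%R.
Proof.
move=> lemn; apply/dvdXnP=> i lim; rewrite coefB !coef_poly lim.
by rewrite (leq_trans lim) ?subrr.
Qed.

Lemma dvdXn_trunc n f j : f 0%N = 0 -> ('X^j %| trunc n f ^+ j)%R.
Proof. by move=> f0; apply: dvdp_exp2r; apply: dvdX_trunc. Qed.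

End Truncation.

Section Exponential.
Variable (f : nat -> rat).
Hypothesis f0 : f 0%N = 0.

Definition exp_trunc n := \sum_(j < n.+1) (j`!%:R : rat)^-1 *: trunc n f ^+ j.

Lemma coef_exp_trunc n i : (i <= n)%N -> (exp_trunc n)`_i = fps_exp f i.
Proof.
move=> lein; rewrite /fps_exp !coef_sum.
rewrite -(big_mkord xpredT (fun j => ((j`!%:R : rat)^-1 *: trunc n f ^+ j)`_i)).
rewrite (big_cat_nat (n := i.+1)) //= [X in _ + X]big1_seq ?addr0; last first.
  move=> j /andP[_]; rewrite mem_index_iota => /andP[ij _].
  by rewrite coefZ (dvdXnP _ _ (dvdXn_trunc n j f0)) ?mulr0.
rewrite big_mkord; apply: eq_bigr => j _; rewrite !coefZ; congr (_ * _).
have /dvdXnP/(_ i (ltnSn i))/eqP := dvdX_exp j (dvdX_trunc_sub f lein).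
by rewrite coefB subr_eq0 => /eqP.
Qed.

(** The derivative of exp(f) is exp(f) f'; for the truncated sum the error is
    the last term f^n / n! times f', which 'X^n divides. *)
Lemma deriv_exp_trunc n :
  ('X^n %| (exp_trunc n)^`() - exp_trunc n * (trunc n f)^`())%R.
Proof.
have -> : (exp_trunc n)^`() =
    (\sum_(j < n) (j`!%:R : rat)^-1 *: trunc n f ^+ j) * (trunc n f)^`().
  rewrite /exp_trunc raddf_sum big_ord_recl /= expr0 linearZ /= derivC scaler0 add0r.
  rewrite mulr_suml; apply: eq_bigr => j _; rewrite /bump /= add1n derivZ deriv_exp /=.
  rewrite -scalerMnr scalerMnl -mulr_natr factS natrM invfM mulrAC mulVf ?pnatr_eq0 // mul1r.
  by rewrite -scalerAl mulrC.
rewrite /exp_trunc big_ord_recr /= -mulrBl opprD addrA subrr sub0r.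
by rewrite -scaleNr -mul_polyC -mulrA dvdp_mull // dvdp_mulr // dvdXn_trunc.
Qed.

Lemma fps_exp_logderiv (P : {poly rat}) : (forall n, P`_n = fps_exp f n) ->
  P`_0 = 1 /\ forall n, ('X^n %| P^`() - P * (trunc n f)^`())%R.
Proof.
move=> PE; split=> [|n].
  by rewrite PE /fps_exp big_ord_recl big_ord0 addr0 expr0 coefZ coef1 invr1 mulr1.
have PX : 'X^(n.+1) %| P - exp_trunc n.
  by apply/dvdXnP=> i lin; rewrite coefB coef_exp_trunc // PE subrr.
have -> : P^`() - P * (trunc n f)^`() = (P - exp_trunc n)^`()
   - (P - exp_trunc n) * (trunc n f)^`() + ((exp_trunc n)^`() - exp_trunc n * (trunc n f)^`()).
  by rewrite derivB; ring.
rewrite dvdp_addr ?deriv_exp_trunc // dvdp_sub ?dvdXn_deriv // dvdp_mulr //.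
by apply: dvdp_trans PX; rewrite dvdp_exp2l.
Qed.

End Exponential.

Section PowerSums.
Variable K : fieldType.

(** The normal form of an L-polynomial: [s] lists the reciprocal roots, which
    for a curve are the Frobenius eigenvalues. *)
Definition rev_roots_poly (s : seq K) : {poly K} := \prod_(a <- s) (1 - a *: 'X).

Lemma geometric_trunc (a : K) n :
  (1 - a *: 'X) * \poly_(i < n) (a ^+ i.+1) = a%:P - a ^+ n.+1 *: 'X^n.
Proof.
apply/polyP=> i; rewrite mulrBl mul1r -scalerAl.
rewrite !coefB !coefZ coefXM coefC coefXn !coef_poly.
case: i => [|i] /=; first by case: n => [|n]; rewrite /= ?expr1 ?mulr1 ?mulr0 ?subr0 ?subrr.
rewrite sub0r; case: (ltngtP i.+1 n) => [lt|lt|<-] /=.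
- by rewrite -exprS subrr mulr0 oppr0.
- by rewrite mulr0 subrr mulr0 oppr0.
- by rewrite sub0r -exprS mulr1.
Qed.

(** Newton's identities: minus the logarithmic derivative generates the power
    sums, since each factor contributes a geometric series. *)
Lemma rev_roots_logderiv (s : seq K) n :
  ('X^n %| (rev_roots_poly s)^`()
     + rev_roots_poly s * \poly_(i < n) (\sum_(a <- s) a ^+ i.+1))%R.
Proof.
rewrite /rev_roots_poly; elim: s => [|a s IH].
  rewrite big_nil derivC add0r mul1r (_ : \poly_(i < n) _ = 0) ?dvdp0 //.
  by apply/polyP=> i; rewrite coef_poly big_nil coef0 if_same.
rewrite big_cons; set R := \prod_(_ <- s) _ in IH *.
set G := \poly_(i < n) _ in IH; set Ga := \poly_(i < n) (a ^+ i.+1).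
have -> : \poly_(i < n) (\sum_(b <- a :: s) b ^+ i.+1) = Ga + G.
  by apply/polyP=> i; rewrite coefD !coef_poly big_cons; case: ifP; rewrite ?addr0.
have -> : ((1 - a *: 'X) * R)^`() + (1 - a *: 'X) * R * (Ga + G)
   = (1 - a *: 'X) * (R^`() + R * G) - (a ^+ n.+1 *: R) * 'X^n.
  rewrite derivM derivB derivZ derivX derivC sub0r.
  have -> : (1 - a *: 'X) * R * (Ga + G)
    = R * ((1 - a *: 'X) * Ga) + (1 - a *: 'X) * R * G by ring.
  by rewrite geometric_trunc -!mul_polyC mulr1; ring.
by rewrite dvdp_sub ?dvdp_mull.
Qed.

Lemma rev_roots_poly0 s : (rev_roots_poly s).[0] = 1.
Proof.
by rewrite horner_prod big1 // => a _; rewrite !hornerE subr0.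
Qed.

Lemma root_rev_roots s x : x != 0 -> root (rev_roots_poly s) x = (x^-1 \in s).
Proof.
move=> x0; rewrite rootE horner_prod prodf_seq_eq0 -has_pred1; apply: eq_has => a /=.
rewrite !hornerE subr_eq0 eq_sym -(inj_eq (mulIf (invr_neq0 x0))) mulfK //.
by rewrite mul1r.
Qed.

Lemma rev_roots_normal (z : seq K) (c : K) (P : {poly K}) :
  P = c *: \prod_(x <- z) ('X - x%:P) -> P.[0] = 1 ->
  0 \notin [seq x^-1 | x <- z] /\ P = rev_roots_poly [seq x^-1 | x <- z].
Proof.
move=> PE P0; have z0 : 0 \notin z.
  apply: contra_eqN P0 => z0; rewrite PE hornerZ (_ : _.[0] = 0) ?mulr0 1?eq_sym ?oner_eq0 //.
  by apply/eqP; rewrite -[_ == _]/(root _ 0) root_prod_XsubC.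
split; first by apply: contra z0 => /mapP[x xz /esym/eqP]; rewrite invr_eq0 => /eqP <-.
have E : \prod_(x <- z) ('X - x%:P) =
    (\prod_(x <- z) - x) *: rev_roots_poly [seq x^-1 | x <- z].
  rewrite /rev_roots_poly big_map; elim: z z0 {PE} => [|x z IH].
    by rewrite !big_nil scale1r.
  rewrite in_cons negb_or eq_sym => /andP[x0 /IH {}IH]; rewrite !big_cons IH.
  rewrite -!mul_polyC polyCM polyCN.
  have e : x%:P * x^-1%:P = 1 :> {poly K} by rewrite -polyCM divff.
  set C := (\prod_(_ <- _) _)%:P; set R := \prod_(_ <- _) _.
  apply/eqP; rewrite -subr_eq0; apply/eqP.
  by transitivity ((1 - x%:P * x^-1%:P) * ('X * C * R)); [ring | rewrite e subrr mul0r].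
move: P0; rewrite PE E scalerA hornerZ rev_roots_poly0 mulr1 => ->.
by rewrite scale1r.
Qed.

End PowerSums.

(** The logarithmic derivative of the L-polynomial is computed in two ways: as
    the derivative of the exponent in its definition, and from the roots. The
    polynomial is invertible modulo powers of 'X, so the two agree. *)
Lemma Lpoly_roots p N (P : {poly int}) : is_Lpoly p N P ->
  exists s : seq algC, [/\ 0 \notin s, map_poly intr P = rev_roots_poly s &
    forall n, \sum_(a <- s) a ^+ n.+1 = (p ^ n.+1)%:R + 1 - (N n)%:R].
Proof.
move=> LP; pose PQ : {poly rat} := map_poly intr P; pose PC : {poly algC} := map_poly intr P.
have PCE : PC = map_poly ratr PQ.
  by rewrite -map_poly_comp; apply: eq_map_poly => x /=; rewrite ratr_int.
have [P0 PD] := @fps_exp_logderiv (log_Lseries p N) erefl PQ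
  (fun n => etrans (coef_map _ _ _) (LP n)).
have [z zE] := closed_field_poly_normal PC.
have PC0 : PC.[0] = 1 by rewrite horner_coef0 PCE coef_map P0 /= rmorph1.
have [s0 sE] := rev_roots_normal zE PC0; set s := map _ _ in s0 sE.
exists s; split=> // n.
pose f := log_Lseries p N.
have d1 : ('X^(n.+1) %| PC^`() - PC * map_poly ratr (trunc n.+1 f)^`()).
  rewrite PCE deriv_map -rmorphM -rmorphB /= -[X in X %| _](map_polyXn ratr).
  by rewrite dvdp_map.
have d2 := rev_roots_logderiv s n.+1; rewrite -sE in d2.
have := dvdp_sub d2 d1; rewrite opprB addrC addrA subrK -mulrDr.
rewrite Gauss_dvdpr; last first.
  by rewrite coprimep_expl // coprimep_sym -['X]subr0 coprimep_XsubC rootE PC0 oner_eq0.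
move/dvdXnP/(_ n (ltnSn n)); rewrite coefD coef_map coef_deriv !coef_poly !ltnSn /=.
rewrite (_ : _ / _ *+ _ = (N n)%:R - (p ^ n.+1)%:R - 1); last first.
  by rewrite -[LHS]mulr_natr divfK ?pnatr_eq0.
rewrite !rmorphB /= !ratr_nat rmorph1 addrC => /eqP.
by rewrite addr_eq0 => /eqP ->; ring.
Qed.

(** * Divisibility of L-polynomials *)

(** The hypothesis is linear in the powers, so it extends to polynomials without
    constant term; one that vanishes at [b] and at every entry of [s] except a
    chosen entry [a0 != b] then gives a contradiction. *)
Lemma power_sums_geometric (s : seq algC) (c : nat) (b : algC) : b != 0 -> 0 \notin s ->
  (forall n, \sum_(a <- s) a ^+ n.+1 = c%:R * b ^+ n.+1) ->
  size s = c /\ {in s, forall a, a = b}.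
Proof.
move=> b0 s0 sE.
have sP (P : {poly algC}) : \sum_(a <- s) a * P.[a] = c%:R * (b * P.[b]).
  under eq_bigr => a _ do rewrite horner_coef mulr_sumr.
  rewrite exchange_big /= horner_coef !mulr_sumr; apply: eq_bigr => i _.
  transitivity (P`_i * \sum_(a <- s) a ^+ i.+1).
    by rewrite mulr_sumr; apply: eq_bigr => a _; rewrite exprS mulrCA.
  by rewrite sE exprS; ring.
have sb : {in s, forall a, a = b}.
  move=> a0 a0s; apply/eqP; apply: contraT => a0b.
  pose P := ('X - b%:P) * \prod_(a <- s | a != a0) ('X - a%:P).
  have Pb : P.[b] = 0 by rewrite /P hornerM !hornerE subrr mul0r.
  have Pa a : a \in s -> a != a0 -> P.[a] = 0.
    move=> ains aa0; rewrite /P (big_rem a) //= aa0 hornerM [X in _ * X]hornerM !hornerE.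
    by rewrite subrr /= mulr0 mul0r.
  have := sP P; rewrite Pb !mulr0.
  rewrite (bigID (pred1 a0)) /= [X in _ + X]big1_seq ?addr0; last first.
    by move=> a /andP[aa0 ains]; rewrite Pa ?mulr0.
  rewrite (eq_bigr (fun=> a0 * P.[a0])) => [|a /eqP-> //].
  rewrite big_const_seq iter_addr_0 => /eqP; rewrite mulrn_eq0 -leqn0 leqNgt -has_count.
  rewrite has_pred1 a0s /= mulf_eq0 (negPf (memPn s0 _ a0s)) /=.
  rewrite /P hornerM !hornerE mulf_eq0 subr_eq0 (negPf a0b) /= horner_prod prodf_seq_eq0.
  by case/hasP=> a _ /andP[aa0]; rewrite !hornerE subr_eq0 eq_sym (negPf aa0).
split=> //; have := sE 0%N.
rewrite (eq_big_seq (fun=> b)) => [|a /sb //]; rewrite big_const_seq iter_addr_0 count_predT.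
by rewrite expr1 mulr_natl -!(mulr_natr b) => /(mulfI b0)/eqP; rewrite eqr_nat => /eqP.
Qed.

(** The points over the extensions of degree 2k(n+1) give all the power sums of
    the 2k-th powers of the eigenvalues. *)
Lemma hermitian_Lpoly_roots p (pr_p : prime p) k (L : {poly int}) : (0 < k)%N ->
  is_Lpoly p (hermitian_count pr_p k) L ->
  exists s : seq algC, [/\ 0 \notin s, map_poly intr L = rev_roots_poly s,
    size s = (p ^ k * (p ^ k).-1)%N, {in s, forall a, a ^+ (2 * k) = - (p ^ k)%:R} &
    forall n, \sum_(a <- s) a ^+ n.+1 =
      (p ^ n.+1)%:R + 1 - (hermitian_count pr_p k n)%:R].
Proof.
move=> k0 LP; have [s [s0 sE sN]] := Lpoly_roots LP.
have q0 : (0 < p ^ k)%N by rewrite expn_gt0 prime_gt0.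
have [] := @power_sums_geometric [seq a ^+ (2 * k) | a <- s] (p ^ k * (p ^ k).-1)
  (- (p ^ k)%:R).
- by rewrite oppr_eq0 pnatr_eq0 -lt0n.
- apply: contra s0 => /mapP[a ains /esym/eqP]; rewrite expf_eq0.
  by case/andP=> _ /eqP <-.
- move=> n; rewrite big_map; under eq_bigr => a _ do rewrite -exprM.
  have e : (2 * k * n.+1 = (2 * k * n.+1).-1.+1)%N by lia.
  rewrite {1}e sN -e.
  have := congr1 (intr : int -> algC) (hermitian_countE pr_p n k0).
  have eX : ((- (p ^ k)%:Z) ^+ n.+1)%:~R = (- (p ^ k)%:R) ^+ n.+1 :> algC.
    by rewrite rmorphXn /= mulrNz.
  rewrite intrB intrD !intrM intrB eX -!pmulrn => ->.
  by rewrite -subn1 natrM natrB //; ring.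
rewrite size_map => sz sa; exists s; split=> // a ains.
by apply: sa; apply: map_f.
Qed.

Theorem theorem22 (p : nat) (pr_p : prime p) (k l : nat)
    (k_gt0 : (0 < k)%N) (l_gt0 : (0 < l)%N) (k_ndvd_l : ~~ (k %| l)%N)
    (Lk Ll : {poly int})
    (LkP : is_Lpoly p (hermitian_count pr_p k) Lk)
    (LlP : is_Lpoly p (hermitian_count pr_p l) Ll) :
  ~ (exists R : {poly int}, Ll = Lk * R).
Proof.
case=> R LlE.
have [s [s0 sE sz sk sN]] := hermitian_Lpoly_roots k_gt0 LkP.
have [t [t0 tE _ tl _]] := hermitian_Lpoly_roots l_gt0 LlP.
have s_sub_t : {subset s <= t}.
  move=> a ains; have a0 : a^-1 != 0 by rewrite invr_eq0 (memPn s0).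
  have : root (rev_roots_poly s) a^-1 by rewrite root_rev_roots // invrK.
  rewrite -sE => ra; have : root (map_poly intr Ll) a^-1 by rewrite LlE rmorphM rootM ra.
  by rewrite tE root_rev_roots // invrK.
pose g := gcdn k l.
have g0 : (0 < g)%N by rewrite gcdn_gt0 k_gt0.
have le2gk : (2 * g <= k)%N.
  have /dvdnP[c ec] : (g %| k)%N := dvdn_gcdl k l.
  case: c ec => [|[|c]] ec; [lia | | by rewrite ec leq_mul2r orbT].
  by case/negP: k_ndvd_l; rewrite ec mul1n dvdn_gcdr.
have p0 m : (p ^ m)%:R != 0 :> algC by rewrite pnatr_eq0 -lt0n expn_gt0 prime_gt0.
have sq (a : algC) m : a ^+ (2 * m) = - (p ^ m)%:R -> a ^+ (4 * m) = (p ^ (2 * m))%:R.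
  move=> e; rewrite (_ : 4 * m = 2 * m * 2)%N; last by ring.
  by rewrite exprM e sqrrN -natrX -expnM mulnC.
(* A Bezout relation u k = v l + g combines the two power identities. *)
have sg : {in s, forall a, a ^+ (4 * g) = (p ^ (2 * g))%:R}.
  move=> a ains; have ek := sq _ _ (sk a ains); have el := sq _ _ (tl a (s_sub_t a ains)).
  case: (egcdnP l k_gt0) => u v uv _; rewrite -/g in uv.
  apply: (mulfI (p0 (2 * l * v)%N)).
  rewrite -natrM -expnD {1}expnM natrX -el -exprM -exprD.
  rewrite (_ : 4 * l * v + 4 * g = 4 * k * u)%N; last by move: uv; lia.
  by rewrite exprM ek -natrX -expnM; congr ((_ ^ _)%:R); move: uv; lia.
(* All eigenvalues agree over the extension of degree 4g, and the number of
   points there, q(q - 1) p^(2g) being too large, would be negative. *)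
have e4g : (4 * g = (4 * g).-1.+1)%N by lia.
have := sN (4 * g).-1; rewrite -e4g (eq_big_seq _ sg) big_const_seq iter_addr_0 count_predT sz.
move/eqP; rewrite eq_sym subr_eq -mulrnA -natrD -[1]/(1%:R) -natrD eqr_nat => /eqP.
have W4 : (4 <= p ^ (2 * g))%N.
  apply: (@leq_trans (2 ^ (2 * g))); last by rewrite leq_exp2r ?prime_gt1 //; lia.
  by apply: (@leq_trans (2 ^ 2)) => //; rewrite leq_pexp2l //; lia.
have qW : (p ^ (2 * g) <= p ^ k)%N by rewrite leq_pexp2l ?prime_gt0.
have -> : (p ^ (4 * g) = p ^ (2 * g) * p ^ (2 * g))%N by rewrite -expnD; congr (_ ^ _)%N; ring.
move: (p ^ (2 * g))%N (p ^ k)%N (hermitian_count _ _ _) W4 qW => W q N W4 qW; clear -W4 qW.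
have : (W * 3 <= q * q.-1)%N by rewrite leq_mul //; lia.
rewrite -(leq_pmul2l (ltn_trans _ W4)) // => le3 e.
by move: le3; rewrite mulnA => le3; have := leq_mul W4 W4; lia.
Qed.
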